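(* Let $N\ge 1$ and let $(M_i,d_i)$, $1\le i\le N$, be Gromov hyperbolic metric spaces of bounded geometry. Then the metric space $M:=\oplus_{i=1}^{N}M_i$ is universal with respect to simultaneous Lipschitz extensions.
   Context: Direct sum: $\oplus_{i=1}^{N}M_i$ is the metric space with underlying set $\prod_{i=1}^{N}M_i$ and metric $d:=\max_{1\le i\le N}d_i$. Lipschitz spaces: for a metric space $(M,d)$ and a Banach space $X$, $Lip(M,X)$ is the space of Lipschitz functions $f:M\to X$ with the seminorm $L(f):=\sup_{m\ne m'}\|f(m)-f(m')\|/d(m,m')$. A subset $S\subset M$ is regarded as a metric space with the induced metric. Extension constant: a simultaneous Lipschitz extension from $S$ to $M$ is a continuous linear operator $T:Lip(S,X)\to Lip(M,X)$ with $Tf|_S=f$ for all $f$. The set of all such $T$ is $Ext(S,M;X)$ and $\lambda(S,M;X):=\inf\{\|T\| : T\in Ext(S,M;X)\}$ ($=\infty$ if $Ext(S,M;X)=\emptyset$), where $\|T\|$ is the operator norm with respect to the seminorms $L$. Universality: a metric space $U$ is universal (with respect to simultaneous Lipschitz extensions) if there is a constant $c(U)$ depending only on $U$ such that for an arbitrary metric space $M$, every subspace $S$ of $M$ isometric to a subspace of $U$, and every Banach space $X$, one has $\lambda(S,M;X)\le c(U)$. $C$-isometric embedding ($C\ge1$): an injection $\phi:(M,d)\to(M_1,d_1)$ with $C^{-1}d(m,m')\le d_1(\phi(m),\phi(m'))\le C\,d(m,m')$ for all $m,m'\in M$. Bounded geometry: a metric space is of bounded geometry with parameters $n,R,C$ if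 every open ball of radius $R$ in it admits a $C$-isometric embedding into Euclidean $\mathbb{R}^n$; it is of bounded geometry if this holds for some integer $n$, some $R>0$ and some $C\ge 1$. Gromov hyperbolic: a geodesic metric space (every two points are joined by a geodesic segment, i.e. the image of a curve $\gamma:[0,a]\to M$ with $d(\gamma(t),\gamma(s))=|t-s|$) is $\delta$-hyperbolic ($\delta\ge0$) if in every geodesic triangle each side lies in the $\delta$-neighbourhood of the union of the other two sides. It is (Gromov) hyperbolic if it is $\delta$-hyperbolic for some $\delta\ge0$. *)

(* Defs.v *)
From HB Require Import structures.
From mathcomp Require Import all_boot all_order all_algebra.
From mathcomp Require Import all_classical all_reals all_analysis.
From mathcomp Require Import ring.
Import Order.TTheory GRing.Theory Num.Theory.
Import numFieldNormedType.Exports.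

Set Implicit Arguments.
Unset Strict Implicit.
Unset Printing Implicit Defensive.

Local Open Scope classical_set_scope.
Local Open Scope ring_scope.

(* A metric space is a [metricType R] (possibly empty) and a Banach space a
   [completeNormedModType R], with [R : realType] the field of real numbers. *)

(* The library already gives the subtype of a set its induced pseudometric;
   this completes it to the induced metric. *)
Section induced_metric.
Context {R : realType} {M : metricType R} (S : set M).

Definition induced_dist (x y : S) : R := mdist (val x) (val y).

Lemma induced_dist_ge0 x y : 0 <= induced_dist x y.
Proof. exact: mdist_ge0. Qed.

Lemma induced_dist_positivity x y : induced_dist x y = 0 -> x = y.
Proof. by move=> /mdist_positivity/val_inj. Qed.

Lemma induced_ballE (x : S) (d : R) :
  ball x d = [set y | induced_dist x y < d].
Proof.
rewrite -[LHS]/((fun y : S => ball (val x) d (val y)) : set S).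
by rewrite ballEmdist.
Qed.

HB.instance Definition _ := @PseudoMetric_isMetric.Build R (S : Type)
  induced_dist induced_dist_ge0 induced_dist_positivity induced_ballE.

End induced_metric.

Definition direct_sum {R : realType} {N : nat} (M : 'I_N -> metricType R) :=
  forall i, M i.

Section direct_sum_metric.
Context {R : realType} {N : nat} (M : 'I_N -> metricType R).

(* The base point 0 of the maximum is harmless: distances are nonnegative. *)
Definition max_dist (x y : direct_sum M) : R :=
  \big[Num.max/0]_(i < N) mdist (x i) (y i).

Lemma max_dist_le (x y : direct_sum M) i : mdist (x i) (y i) <= max_dist x y.
Proof. exact: (le_bigmax _ (fun i => mdist (x i) (y i))). Qed.

Lemma max_distxx x : max_dist x x = 0.
Proof.
rewrite /max_dist; elim/big_ind: _ => // [a b -> ->|i _].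
  by rewrite maxxx.
by rewrite mdistxx.
Qed.

Lemma max_dist_positivity x y : max_dist x y = 0 -> x = y.
Proof.
move=> xy0; apply/functional_extensionality_dep => i; apply: mdist_positivity.
by apply/eqP; rewrite eq_le mdist_ge0 andbT -xy0 max_dist_le.
Qed.

Lemma max_dist_sym x y : max_dist x y = max_dist y x.
Proof. by apply: eq_bigr => i _; rewrite metric_sym. Qed.

Lemma max_dist_triangle y x z : max_dist x z <= max_dist x y + max_dist y z.
Proof.
apply/bigmax_leP; split=> [|i _].
  by rewrite addr_ge0// /max_dist; elim/big_ind: _ => // [a b a0 b0|i _];
    rewrite ?le_max ?a0// mdist_ge0.
by rewrite (le_trans (metric_triangle _ (y i) _))// lerD// max_dist_le.
Qed.

HB.instance Definition _ := Choice.copy (direct_sum M) (forall i, M i).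
HB.instance Definition _ := isMetric.Build R (direct_sum M)
  max_distxx max_dist_positivity max_dist_sym max_dist_triangle.

End direct_sum_metric.

(* The library's metric on ['rV[R]_n] is the sup metric, hence this alias. *)
Definition euclidean (R : realType) (n : nat) := 'rV[R]_n.

Section euclidean_metric.
Context {R : realType} {n : nat}.

Definition euclidean_dist (x y : euclidean R n) : R :=
  Num.sqrt (\sum_(i < n) (x 0 i - y 0 i) ^+ 2).

Lemma euclidean_distxx x : euclidean_dist x x = 0.
Proof.
by rewrite /euclidean_dist big1 ?sqrtr0// => i _; rewrite subrr expr0n.
Qed.

Lemma euclidean_dist_positivity x y : euclidean_dist x y = 0 -> x = y.
Proof.
move/eqP; rewrite sqrtr_eq0 => xy0; apply/rowP => i; apply/eqP.
rewrite -subr_eq0 -sqrf_eq0 eq_le sqr_ge0 andbT (le_trans _ xy0)//.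
by rewrite (bigD1 i)//= lerDl sumr_ge0// => j _; exact: sqr_ge0.
Qed.

Lemma euclidean_dist_sym x y : euclidean_dist x y = euclidean_dist y x.
Proof.
by congr Num.sqrt; apply: eq_bigr => i _; rewrite -sqrrN opprB.
Qed.

Lemma sum_cauchy_schwarz (a b : 'I_n -> R) :
  (\sum_i a i * b i) ^+ 2 <= (\sum_i a i ^+ 2) * (\sum_i b i ^+ 2).
Proof.
have lagrange : \sum_i \sum_j (a i * b j - a j * b i) ^+ 2 =
    ((\sum_i a i ^+ 2) * (\sum_i b i ^+ 2) - (\sum_i a i * b i) ^+ 2) *+ 2.
  rewrite (eq_bigr (fun i => \sum_j a i ^+ 2 * b j ^+ 2 +
      \sum_j a j ^+ 2 * b i ^+ 2 - (\sum_j a i * b i * (a j * b j)) *+ 2)).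
    rewrite big_split/= big_split/= sumrN sumrMnl.
    rewrite [X in _ + X - _]exchange_big/= -!big_distrlr/=.
    by rewrite -expr2 -mulr2n -mulrnBl.
  move=> i _; rewrite -sumrMnl -sumrN -!big_split/=; apply: eq_bigr => j _.
  by ring.
rewrite -subr_ge0 -(@pmulrn_lge0 _ _ 2)// -lagrange.
by apply: sumr_ge0 => i _; apply: sumr_ge0 => j _; exact: sqr_ge0.
Qed.

Lemma euclidean_dist_triangle y x z :
  euclidean_dist x z <= euclidean_dist x y + euclidean_dist y z.
Proof.
have sq0 (f : 'I_n -> R) : 0 <= \sum_i f i ^+ 2.
  by apply: sumr_ge0 => i _; exact: sqr_ge0.
rewrite -(@ler_pXn2r _ 2)// ?nnegrE ?addr_ge0 ?sqrtr_ge0// sqrrD !sqr_sqrtr//.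
rewrite (eq_bigr (fun i => (x 0 i - y 0 i) ^+ 2 +
    ((x 0 i - y 0 i) * (y 0 i - z 0 i)) *+ 2 + (y 0 i - z 0 i) ^+ 2)); last first.
  by move=> i _; rewrite -sqrrD addrA subrK.
rewrite 2!big_split/= lerD2r lerD2l sumrMnl lerMn2r/=.
rewrite (le_trans (ler_norm _))// -sqrtr_sqr -sqrtrM// ler_wsqrtr//.
exact: sum_cauchy_schwarz.
Qed.

HB.instance Definition _ := Choice.copy (euclidean R n) 'rV[R]_n.
HB.instance Definition _ := isMetric.Build R (euclidean R n)
  euclidean_distxx euclidean_dist_positivity euclidean_dist_sym
  euclidean_dist_triangle.

End euclidean_metric.

Definition isometric {R : realType} (A B : metricType R) : Prop :=
  exists phi : A -> B,
    bijective phi /\ forall x y, mdist (phi x) (phi y) = mdist x y.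

Section lipschitz_space.
Context {R : realType} (M : metricType R) (X : completeNormedModType R).

(* The library's [lipschitz] requires a normed module as domain. *)
Definition metric_lipschitz : {pred M -> X} := mem [set f : M -> X |
  exists k : R, forall x y, `|f x - f y| <= k * mdist x y].

Lemma metric_lipschitz_submod_closed : submod_closed metric_lipschitz.
Proof.
split=> [|a f g].
  by rewrite inE/=; exists 0 => x y; rewrite mul0r subrr normr0.
rewrite !inE/= => -[k fk] [l gl]; exists (`|a| * k + l) => x y.
rewrite -[leLHS]/(`|(a *: f x + g x) - (a *: f y + g y)|).
rewrite opprD addrACA -scalerBr (le_trans (ler_normD _ _))// normrZ mulrDl.
by rewrite lerD// -mulrA ler_wpM2l.
Qed.

HB.instance Definition _ :=
  GRing.isSubmodClosed.Build R (M -> X) metric_lipschitz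
    metric_lipschitz_submod_closed.

Record Lip := MkLip {
  lip_fun :> M -> X ;
  lip_funP : lip_fun \in metric_lipschitz }.

HB.instance Definition _ := [isSub for lip_fun].
HB.instance Definition _ := [Choice of Lip by <:].
HB.instance Definition _ := [SubChoice_isSubLmodule of Lip by <:].

(* [sup] is taken in [R]: the set is bounded above because [f] is Lipschitz,
   and the supremum of the empty set is 0. *)
Definition lip_seminorm (f : Lip) : R :=
  sup [set r | exists x y : M, x <> y /\ r = `|f x - f y| / mdist x y].

End lipschitz_space.

Section operators.
Context {R : realType} {A B : metricType R} {X : completeNormedModType R}.

(* Continuity for the topologies defined by the seminorms. *)
Definition lip_continuous (T : Lip A X -> Lip B X) : Prop :=
  forall f (e : R), 0 < e -> exists2 d : R, 0 < d &
    forall g, lip_seminorm (g - f) < d -> lip_seminorm (T g - T f) < e.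

Definition operator_norm (T : Lip A X -> Lip B X) : \bar R :=
  ereal_sup [set (lip_seminorm (T f))%:E | f in [set f | lip_seminorm f <= 1]].

End operators.

Section extension.
Context {R : realType} {M : metricType R} (S : set M)
  (X : completeNormedModType R).

Definition Ext : set {linear Lip S X -> Lip M X} := [set T |
  lip_continuous T /\ forall (f : Lip S X) (s : S), T f (val s) = f s].

(* [+oo] when [Ext] is empty *)
Definition extension_constant : \bar R :=
  ereal_inf [set operator_norm T | T in Ext].

End extension.

Definition universal {R : realType} (U : metricType R) : Prop :=
  exists c : R, forall (M : metricType R) (S : set M),
    (exists V : set U, isometric S V) ->
    forall X : completeNormedModType R, (extension_constant S X <= c%:E)%E.

Definition C_isometric_embedding {R : realType} {A B : metricType R} (C : R)
    (phi : A -> B) : Prop :=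
  injective phi /\ forall x y,
    C^-1 * mdist x y <= mdist (phi x) (phi y) <= C * mdist x y.

Definition bounded_geometry_with {R : realType} (M : metricType R)
    (n : nat) (r C : R) : Prop :=
  forall x : M, exists phi : (ball x r : set M) -> euclidean R n,
    C_isometric_embedding C phi.

Definition bounded_geometry {R : realType} (M : metricType R) : Prop :=
  exists (n : nat) (r C : R),
    [/\ 0 < r, 1 <= C & bounded_geometry_with M n r C].

Section hyperbolic.
Context {R : realType} (M : metricType R).

Definition geodesic_segment (x y : M) (A : set M) : Prop :=
  exists (a : R) (gamma : R -> M),
    [/\ 0 <= a, gamma 0 = x, gamma a = y,
        {in `[0, a] &, forall t s, mdist (gamma t) (gamma s) = `|t - s|}
      & A = gamma @` `[0, a]].

Definition geodesic_space : Prop :=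
  forall x y : M, exists A, geodesic_segment x y A.

(* Closed, so that 0-hyperbolicity is meaningful. *)
Definition neighbourhood (delta : R) (A : set M) : set M :=
  [set p | exists2 q, A q & mdist p q <= delta].

Definition delta_hyperbolic (delta : R) : Prop :=
  forall (x y z : M) (A B C : set M),
    geodesic_segment x y A -> geodesic_segment y z B ->
    geodesic_segment z x C ->
    [/\ A `<=` neighbourhood delta (B `|` C),
        B `<=` neighbourhood delta (C `|` A)
      & C `<=` neighbourhood delta (A `|` B)].

Definition gromov_hyperbolic : Prop :=
  geodesic_space /\ exists2 delta : R, 0 <= delta & delta_hyperbolic delta.

End hyperbolic.

(* Main.v *)
From HB Require Import structures.
Require Import Defs.
From mathcomp Require Import all_boot all_order all_algebra.
From mathcomp Require Import all_classical all_reals all_analysis.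
From mathcomp Require Import zify lra ring.
Import Order.TTheory GRing.Theory Num.Theory.
Import numFieldNormedType.Exports.

Set Implicit Arguments.
Unset Strict Implicit.
Unset Printing Implicit Defensive.

Local Open Scope classical_set_scope.
Local Open Scope ring_scope.

(** The theorem is a statement about dimension.  Say that a space [T] has finite
Nagata dimension if, for constants [K] and [c] and every scale [s > 0], there
is a quantizer [p : T -> T] at scale [s]: it moves points by at most [c * s] and
takes at most [K] values on each ball of radius [s].  The proof has two halves.

A Gromov hyperbolic space of bounded geometry has finite Nagata dimension
([hyperbolic_nagata]).  At small scales sending each point to a nearby
point of a maximal separated set is a quantizer, because balls embed in a Euclidean space, where
separated sets are counted with a grid ([packing]); geodesics propagate this
count to any bounded range of scales ([bounded_scale_nagata]).  At a large scale
[s], push each point along a geodesic towards a base point [e], to a sphere about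
[e] whose radius is a multiple of [3 * s] and is smaller by [3 * s] to [6 * s]
than the distance of the point to [e] (points within [3 * s] of [e] go to [e]);
then quantize at a fixed scale a little larger than [2 * delta].  The points of a
ball of radius [s] lie in three consecutive annuli of width [3 * s].  Those in
one annulus are pushed to points within [2 * delta] of each other, because
triangles are thin ([fellow_travel]), so the number of values of the quantizer
on the ball is bounded independently of [s].

A space [S] of finite Nagata dimension admits simultaneous extensions out of
every space containing it, with a norm that depends on [K] and [c] only
([nagata_extension_constant]).  Take quantizers [p k] at scales comparable with
[2 ^ k].  For a point [x] of the ambient space and a height [t] larger than its
distance to [S], average the values [f y] with weights that are Lipschitz in
[(x, t)], nonzero only when [2 ^ k] is comparable with [t] and some point of the
cell [p k = y] is near [x].  Boundedly many weights are nonzero and the largest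
is comparable with [t], so the average is Lipschitz in [(x, t)]
([extend_at_lip]).  The extension is the limit when [t] decreases to the
distance from [x] to [S]; working at a height above that distance treats the
points outside the closure of [S], on its boundary and in [S] in the same way.

Quantizers pass to finite sums with the maximum metric, where balls are products
of balls ([nagata_direct_sum]), and, with [2 * c] in place of [c], to every
space that embeds isometrically ([nagata_isometric]).  This gives one constant
for all subspaces of the sum. *)

(** * Separated nets and packing *)

Lemma codable_enum (T : choiceType) (J : finType) (A : set T) (code : T -> J) :
  (forall a b, A a -> A b -> code a = code b -> a = b) ->
  exists l : seq T, (size l <= #|J|)%N /\ forall a, A a -> a \in l.
Proof.
move=> codeI; case: (pselect (A !=set0)) => [[a0 _]|A0]; last first.
  by exists [::]; split=> // a Aa; case: A0; exists a.
pose pt j := xget a0 [set a | A a /\ code a = j].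
exists [seq pt j | j <- enum J]; split=> [|a Aa]; first by rewrite size_map cardE.
apply/mapP; exists (code a); first by rewrite mem_enum.
have [Ap cp] : [set b | A b /\ code b = code a] (pt (code a)).
  by apply: xgetPex; exists a.
exact: codeI.
Qed.

Section nets.
Context {R : realType} {T : metricType R}.
Implicit Types (x y z : T) (p : T -> T).

(** The values of [p] form a maximal [e]-separated set: a point at distance at least
[e] from such a set could be added to it. *)
Lemma separated_net (e : R) : 0 < e ->
  exists p, (forall x, mdist x (p x) < e) /\
    (forall x y, mdist (p x) (p y) < e -> p x = p y).
Proof.
move=> e0.
pose sep (A : set T) := forall a b, A a -> A b -> mdist a b < e -> a = b.
have [|A [sepA maxA]] := @Zorn_bigcup T sep.
  move=> F Fsep Ftot a b [X FX Xa] [Y FY Yb].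
  have [XY|YX] := Ftot _ _ FX FY.
    by apply: (Fsep _ FY) => //; exact: XY.
  by apply: (Fsep _ FX) => //; exact: YX.
have near x : exists a, A a /\ mdist x a < e.
  apply: contrapT => far; case: (maxA (A `|` [set x])).
    split; first by move=> a Aa; left.
    move/(_ x (or_intror erefl)) => Ax; apply: far; exists x.
    by rewrite mdistxx.
  move=> a b [Aa|->] [Ab|->] //; first exact: sepA.
  - by rewrite metric_sym => xa; case: far; exists a.
  - by move=> xb; case: far; exists b.
have [p pP] := choice near.
exists p; split=> [x|x y pxy]; first by have [] := pP x.
by apply: sepA pxy; have [] := pP x; have [] := pP y.
Qed.

Definition locally_few (K : nat) (r : R) p := forall x,
  exists l : seq T, (size l <= K)%N /\ forall z, mdist x z < r -> p z \in l.

End nets.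

Section packing.
Context {R : realType}.

Lemma euclidean_coord n (u v : euclidean R n) i :
  `|u 0 i - v 0 i| <= mdist u v.
Proof.
rewrite -sqrtr_sqr ler_wsqrtr// (bigD1 i)//= lerDl sumr_ge0// => j _.
exact: sqr_ge0.
Qed.

Lemma euclidean_dist_le n (u v : euclidean R n) (w : R) : 0 <= w ->
  (forall i, `|u 0 i - v 0 i| <= w) -> mdist u v <= n.+1%:R * w.
Proof.
move=> w0 uvw.
have nw0 : 0 <= n.+1%:R * w by rewrite mulr_ge0.
rewrite -(ger0_norm nw0) -sqrtr_sqr ler_wsqrtr//.
have /le_trans -> // : \sum_(i < n) (u 0 i - v 0 i) ^+ 2 <= \sum_(i < n) w ^+ 2.
  apply: ler_sum => i _; rewrite -real_normK ?num_real//.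
  by rewrite ler_pXn2r// nnegrE.
rewrite sumr_const card_ord exprMn -[leLHS]mulr_natl ler_wpM2r ?sqr_ge0//.
by rewrite -natrX ler_nat expnS (leq_trans (leqnSn n))// leq_pmulr.
Qed.

Context {T : metricType R}.

(** A ball of radius at most [r] embeds in a Euclidean space with distortion [C].
In a grid fine enough that a cell has diameter less than [e / C], separated
points occupy different cells, and the number of cells met depends only on [n],
[C] and the ratio [Q] of the radius to the separation. *)
Lemma packing n (r C : R) : 0 < r -> 1 <= C -> bounded_geometry_with T n r C ->
  forall Q : R, exists K : nat, forall (e : R) (x : T) (A : set T),
    0 < e -> Q * e <= r -> (forall a b, A a -> A b -> mdist a b < e -> a = b) ->
    exists l : seq T, (size l <= K)%N /\
      forall a, A a -> mdist x a < Q * e -> a \in l.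
Proof.
move=> r0 C1 geo Q.
have C0 : 0 < C by rewrite (lt_le_trans _ C1).
have [m mP] : exists m : nat, 2 * C ^+ 2 * n.+1%:R * Q < m%:R.
  by exists (Num.truncn (2 * C ^+ 2 * n.+1%:R * Q)).+1; exact: truncnS_gt.
exists #|{ffun 'I_n -> 'I_(m + m).+1}| => e x A e0 Qe sepA.
have [phi [_ phiC]] := geo x.
pose psi (z : T) : euclidean R n :=
  if pselect (ball x r z) is left xz then phi (SigSub (mem_set xz)) else 0.
have psiC y z : mdist x y < Q * e -> mdist x z < Q * e ->
    C^-1 * mdist y z <= mdist (psi y) (psi z) <= C * mdist y z.
  move=> xy xz; have [yb zb] : ball x r y /\ ball x r z.
    by rewrite ballEmdist/=; split; exact: lt_le_trans Qe.
  rewrite /psi; case: pselect => // yb'; case: pselect => // zb'.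
  exact: (phiC (SigSub (mem_set yb')) (SigSub (mem_set zb'))).
(* A cell of side [w] has diameter at most [n.+1 * w = e / (2 * C) < e / C]. *)
pose w := e / (2 * C * n.+1%:R).
have w0 : 0 < w by rewrite divr_gt0// !mulr_gt0.
pose u z i := (psi z 0 i - psi x 0 i) / w.
have uB z i : mdist x z < Q * e -> `|u z i| < m%:R.
  move=> xz; have xx : mdist x x < Q * e.
    by rewrite mdistxx (le_lt_trans (mdist_ge0 x z)).
  rewrite normrM normfV (gtr0_norm w0) ltr_pdivrMr//.
  rewrite (le_lt_trans (euclidean_coord _ _ _))//.
  have /andP[_ /le_lt_trans->//] := psiC z x xz xx.
  rewrite metric_sym (@lt_trans _ _ (C * (Q * e)))// ?ltr_pM2l//.
  have -> : C * (Q * e) = (2 * C ^+ 2 * n.+1%:R * Q) * w.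
    by rewrite /w; field; rewrite addrC natr1 pnatr_eq0 lt0r_neq0.
  by rewrite ltr_pM2r.
pose code z : {ffun 'I_n -> 'I_(m + m).+1} :=
  [ffun i => inord (absz (Num.floor (u z i) + m%:Z)%R)].
have floorB z i : mdist x z < Q * e ->
    0 <= Num.floor (u z i) + m%:Z /\ (absz (Num.floor (u z i) + m%:Z)%R < (m + m).+1)%N.
  move=> /(uB z i); rewrite ltr_norml => /andP[lo hi].
  have f0 : 0 <= Num.floor (u z i) + m%:Z.
    by rewrite -lerBlDr sub0r floor_ge_int intrN ltW.
  split=> //; rewrite -ltz_nat gez0_abs// intS [1 + _]addrC ltzD1 PoszD lerD2r.
  by rewrite -(ler_int R) (le_trans (floor_le _))// ltW.
have [a b [Aa xa] [Ab xb] ab|l [lK lA]] :=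
  @codable_enum T _ [set a | A a /\ mdist x a < Q * e] code; last first.
  by exists l; split=> // a Aa xa; apply: lA.
apply: sepA => //.
have /andP[+ _] := psiC a b xa xb; rewrite mulrC ler_pdivrMr// => /le_lt_trans; apply.
rewrite -ltr_pdivlMr//.
apply: (@le_lt_trans _ _ (n.+1%:R * w)); last first.
  rewrite /w -subr_gt0.
  have -> : e / C - n.+1%:R * (e / (2 * C * n.+1%:R)) = e / (2 * C).
    by field; rewrite addrC natr1 pnatr_eq0 lt0r_neq0.
  by rewrite divr_gt0// mulr_gt0.
apply: euclidean_dist_le; first exact: ltW.
move=> i; move/ffunP/(_ i) : ab; rewrite !ffunE => /(congr1 val).
have [a0 am] := floorB a i xa; have [b0 bm] := floorB b i xb.
rewrite /= !inordK// => /(congr1 Posz); rewrite !gez0_abs// => /addIr fab.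
have : `|u a i - u b i| <= 1.
  have /andP[] := floor_itv (u a i); have /andP[] := floor_itv (u b i).
  rewrite fab ler_norml; set f := Num.floor _; rewrite intrD; lra.
have -> : u a i - u b i = (psi a 0 i - psi b 0 i) / w by rewrite /u; ring.
by rewrite normrM normfV (gtr0_norm w0) ler_pdivrMr// mul1r.
Qed.

(** The map to a maximal [s / 2]-separated set.  The displacement [s / 2], rather
than [s], leaves the room that [geodesic_growth] needs. *)
Lemma local_quantizer n (r C : R) :
  0 < r -> 1 <= C -> bounded_geometry_with T n r C ->
  exists K : nat, forall s : R, 0 < s -> s <= r / 2 ->
    exists p : T -> T, (forall x, mdist x (p x) <= s / 2) /\ locally_few K s p.
Proof.
move=> r0 C1 geo; have [K KP] := packing r0 C1 geo 3.
exists K => s s0 sr; have [|p [px psep]] := @separated_net R T (s / 2).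
  by rewrite divr_gt0.
exists p; split=> [x|x]; first exact/ltW/px.
have [||_ _ [a _ <-] [b _ <-]|l [lK lP]] := KP (s / 2) x (range p).
- by rewrite divr_gt0.
- lra.
- exact: psep.
exists l; split=> // z xz; apply: lP; first by exists z.
have := metric_triangle x z (p z); have := px z; lra.
Qed.

End packing.

(** * Nagata dimension and its permanence properties *)

Lemma dep_choice (I : Type) (U : I -> Type) (P : forall i, U i -> Prop) :
  (forall i, exists x, P i x) -> exists f : forall i, U i, forall i, P i (f i).
Proof. by move=> PU; exists (fun i => projT1 (cid (PU i))) => i; case: cid. Qed.

(** Usually one asks for a cover by sets of diameter at most a multiple of [s] of
which each [s]-ball meets at most [K].  The fibres of [p] form such a cover, and
recording them through a self-map makes sums and subspaces easy to treat. *)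
Definition nagata {R : realType} (T : metricType R) (K : nat) (c : R) : Prop :=
  forall s : R, 0 < s ->
    exists p : T -> T, (forall x, mdist x (p x) <= c * s) /\ locally_few K s p.

Section nagata_closure.
Context {R : realType}.

Lemma locally_few_mono (T : metricType R) (p : T -> T) (K K' : nat) (r r' : R) :
  (K <= K')%N -> r' <= r -> locally_few K r p -> locally_few K' r' p.
Proof.
move=> KK rr few x; have [l [lK lP]] := few x.
exists l; split=> [|z xz]; first exact: leq_trans KK.
by apply: lP; exact: lt_le_trans rr.
Qed.

(** Each value [y] of [p] that is attained on the copy of [A] is replaced by a point
[q y] of [A] in the same fibre.  The copies of [q y] and of any other point of
the fibre are within [c * s] of [y], hence the factor [2]. *)
Lemma nagata_isometric (A B : metricType R) (psi : A -> B) K (c : R) :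
  (forall x y, mdist (psi x) (psi y) = mdist x y) ->
  nagata B K c -> nagata A K (2 * c).
Proof.
move=> iso nB s s0; have [p [pd pfew]] := nB s s0.
case: (pselect ([set: A] !=set0)) => [[a0 _]|A0]; last first.
  by exists id; split=> x; case: A0; exists x.
pose q y := xget a0 [set a | p (psi a) = y].
have pq a : p (psi (q (p (psi a)))) = p (psi a).
  by have : [set b | p (psi b) = p (psi a)] (q (p (psi a))) by apply: xgetPex; exists a.
exists (fun a => q (p (psi a))); split=> [a|x].
  rewrite -iso (le_trans (metric_triangle _ (p (psi a)) _))//.
  have := pd (psi a); have := pd (psi (q (p (psi a)))).
  rewrite pq (metric_sym (psi (q _))); lra.
have [l [lK lP]] := pfew (psi x).
exists [seq q y | y <- l]; split=> [|z xz]; first by rewrite size_map.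
by apply: map_f; apply: lP; rewrite iso.
Qed.

Lemma nagata_direct_sum N (M : 'I_N -> metricType R) :
  (forall i, exists K c, 0 <= c /\ nagata (M i) K c) ->
  exists K c, 0 <= c /\ nagata (direct_sum M) K c.
Proof.
move=> /choice[K /choice[c MKc]].
exists #|{ffun 'I_N -> 'I_(\sum_i K i).+1}|, (\sum_i c i).
have c0 i : 0 <= c i by have [] := MKc i.
split=> [|s s0]; first exact: sumr_ge0.
have /dep_choice[p pP] i : exists p : M i -> M i,
    (forall x, mdist x (p x) <= c i * s) /\ locally_few (K i) s p.
  by have [_] := MKc i; apply.
exists (fun x i => p i (x i)); split=> [x|x].
  apply/bigmax_leP; split=> [|i _]; first by rewrite mulr_ge0 ?sumr_ge0// ltW.
  have [/(_ (x i)) /le_trans-> //] := pP i.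
  by rewrite ler_pM2r// (bigD1 i)//= lerDl sumr_ge0.
have /dep_choice[l lP] i : exists l : seq (M i), (size l <= K i)%N /\
    forall z, mdist (x i) z < s -> p i z \in l by have [_] := pP i; apply.
pose A : set (direct_sum M) := [set y | forall i, y i \in l i].
pose code (y : direct_sum M) : {ffun 'I_N -> 'I_(\sum_i K i).+1} :=
  [ffun i => inord (index (y i) (l i))].
have [a b aA bA ab|L [LK LA]] := @codable_enum _ _ A code.
  apply: functional_extensionality_dep => i.
  have idx y : A y -> (index (y i) (l i) < (\sum_i K i).+1)%N.
    move=> yA; rewrite ltnS (leq_trans (index_size _ _))//.
    have [lK _] := lP i; rewrite (leq_trans lK)//.
    by rewrite (bigD1 i)//= leq_addr.
  move/ffunP/(_ i)/(congr1 val) : ab; rewrite !ffunE /= !inordK ?idx//.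
  move=> /(congr1 (nth (a i) (l i))).
  by rewrite !nth_index ?aA ?bA.
exists L; split=> // z xz; apply: LA => i.
have [_] := lP i; apply; exact: le_lt_trans (max_dist_le x z i) xz.
Qed.

End nagata_closure.

(** * Geodesics *)

Lemma size_flatten_map (U : Type) (f : U -> seq U) (K : nat) (l : seq U) :
  (forall y, size (f y) <= K)%N ->
  (size (flatten [seq f y | y <- l]) <= size l * K)%N.
Proof.
by move=> fK; elim: l => //= y l IH; rewrite size_cat mulSn leq_add.
Qed.

Section geodesics.
Context {R : realType} {T : metricType R}.
Implicit Types (x y z : T) (A : set T) (p : T -> T).

Lemma geodesic_segment_sym x y A : geodesic_segment x y A -> geodesic_segment y x A.
Proof.
move=> [a [g [a0 g0 ga giso ->]]]; exists a, (fun t => g (a - t)).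
split=> //; rewrite ?subr0 ?subrr//; first move=> t s.
  rewrite !in_itv/= => /andP[t0 ta] /andP[s0 sa].
  rewrite giso ?in_itv/= ?subr_ge0 ?ta ?sa ?gerBl ?t0//.
  by rewrite distrC; congr (`| _ |); ring.
apply/seteqP; split=> _ [t + <-]; rewrite /= in_itv/= => /andP[t0 ta].
  exists (a - t); first by rewrite /= in_itv/= subr_ge0 ta gerBl.
  by congr g; ring.
by exists (a - t); first by rewrite /= in_itv/= subr_ge0 ta gerBl.
Qed.

Lemma geodesic_segment_mdist x y A z w : geodesic_segment x y A ->
  A z -> A w -> mdist z w = `|mdist x z - mdist x w|.
Proof.
move=> [a [g [a0 g0 ga giso ->]]] [t + <-] [s + <-].
rewrite /= !in_itv/= => /andP[t0 ta] /andP[s0 sa].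
rewrite -g0 !giso ?in_itv/= ?lexx ?t0 ?s0 ?ta ?sa//.
by rewrite !sub0r !normrN !(ger0_norm t0) !(ger0_norm s0).
Qed.

Lemma geodesic_segment_le x y A z : geodesic_segment x y A ->
  A z -> mdist x z <= mdist x y.
Proof.
move=> [a [g [a0 g0 ga giso ->]]] [t + <-].
rewrite /= in_itv/= => /andP[t0 ta].
by rewrite -g0 -ga !giso ?in_itv/= ?lexx ?a0 ?t0 ?ta// !sub0r !normrN !ger0_norm.
Qed.

Lemma geodesic_segment_end x y A : geodesic_segment x y A -> A y.
Proof.
move=> [a [g [a0 g0 ga giso ->]]].
by exists a => //; rewrite /= in_itv/= a0 lexx.
Qed.

Lemma geodesic_segment_at x y A t : geodesic_segment x y A ->
  0 <= t <= mdist x y -> exists2 z, A z & mdist x z = t.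
Proof.
move=> [a [g [a0 g0 ga giso ->]]] /andP[t0].
rewrite -g0 -ga giso ?in_itv/= ?a0 ?lexx// sub0r normrN ger0_norm// => ta.
exists (g t); first by exists t; rewrite //= in_itv/= t0.
by rewrite giso ?in_itv/= ?lexx ?a0 ?t0// sub0r normrN ger0_norm.
Qed.

(** A point at distance [D + s / 4] from [x] has, on a geodesic to [x], a point [w]
at distance [D] from [x] and [s / 4] from it.  Being within [3 * s / 4 < s] of
[p w], it has its own value among the at most [K] values of [p] near [p w].  So
each enlargement of the radius by [s / 4] keeps the number of values finite. *)
Lemma geodesic_growth p K (s : R) : geodesic_space T -> 0 < s ->
  (forall x, mdist x (p x) <= s / 2) -> locally_few K s p ->
  forall D : R, exists K', locally_few K' D p.
Proof.
move=> geo s0 pd few.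
suff step m : exists K', locally_few K' (m%:R * (s / 4)) p.
  move=> D; have [K' K'few] := step (Num.truncn (D / (s / 4))).+1.
  exists K'; apply: locally_few_mono K'few => //.
  by rewrite -ler_pdivrMr ?divr_gt0// ltW// truncnS_gt.
have [l lP] := choice few.
elim: m => [|m [K' IH]].
  exists 0%N => x; exists [::]; split=> // z.
  by rewrite mul0r ltNge mdist_ge0.
exists (K + K' * K)%N => x; have [l' [l'K l'P]] := IH x.
exists (l x ++ flatten [seq l y | y <- l']); split.
  rewrite size_cat leq_add//; first by have [] := lP x.
  rewrite (leq_trans (size_flatten_map (K := K) _ _))// ?leq_mul2r ?l'K ?orbT//.
  by move=> y; have [] := lP y.
move=> z xz; rewrite mem_cat.
have [xzs|sxz] := ltP (mdist x z) s.
  by have [_ /(_ _ xzs)->] := lP x.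
have [A segA] := geo x z.
have [|w Aw xw] := @geodesic_segment_at _ _ _ (mdist x z - s / 4) segA; first lra.
have wz : mdist w z = s / 4.
  rewrite (geodesic_segment_mdist segA Aw (geodesic_segment_end segA)) xw.
  by rewrite addrAC subrr sub0r normrN ger0_norm// divr_ge0// ltW.
apply/orP; right; apply/flatten_mapP; exists (p w).
  by apply: l'P; rewrite xw; move: xz; rewrite -natr1; lra.
have [_] := lP (p w); apply.
have := metric_triangle (p w) w z; have := pd w; rewrite (metric_sym w (p w)); lra.
Qed.

(** Above the radius of bounded geometry a single quantizer, taken at the largest
scale available locally, serves all scales up to [s1]. *)
Lemma bounded_scale_nagata : geodesic_space T -> bounded_geometry T ->
  forall s1 : R, exists K, forall s, 0 < s -> s <= s1 ->
    exists p, (forall x, mdist x (p x) <= s) /\ locally_few K s p.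
Proof.
move=> geo [n [r [C [r0 C1 bg]]]] s1.
have [K KP] := local_quantizer r0 C1 bg.
have r20 : 0 < r / 2 by rewrite divr_gt0.
have [q [qd qfew]] := KP _ r20 (lexx _).
have [K' K'few] := geodesic_growth geo r20 qd qfew s1.
exists (K + K')%N => s s0 ss1; have [sr|rs] := leP s (r / 2).
  have [p [pd pfew]] := KP s s0 sr; exists p; split=> [x|].
    by rewrite (le_trans (pd x))//; lra.
  by apply: locally_few_mono pfew => //; rewrite leq_addr.
exists q; split=> [x|]; first by rewrite (le_trans (qd x))//; lra.
by apply: locally_few_mono K'few => //; rewrite leq_addl.
Qed.

(** In the triangle [e], [x], [z] the point [u] cannot be [delta]-close to the side
from [x] to [z]: that side stays within [2 * s] of [x], whereas [u] is at least
[3 * s] closer to [e] than [x].  So [u] is [delta]-close to a point [q] of the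
geodesic from [e] to [z], and [q] and [v], on that geodesic, differ by at most
[delta] in their distance to [e]. *)
Lemma fellow_travel (delta s tau : R) (e x z u v : T) (A C : set T) :
  geodesic_space T -> delta_hyperbolic T delta -> delta <= s ->
  geodesic_segment e x A -> geodesic_segment e z C -> A u -> C v ->
  mdist e u = tau -> mdist e v = tau ->
  mdist x z < 2 * s -> tau + 3 * s <= mdist e x ->
  mdist u v <= 2 * delta.
Proof.
move=> geo hyp ds segA segC Au Cv eu ev xz ex.
have [B segB] := geo x z.
have [/(_ u Au) [q [Bq|Cq] uq] _ _] :=
  hyp _ _ _ _ _ _ segA segB (geodesic_segment_sym segC).
  have xq := geodesic_segment_le segB Bq.
  have := metric_triangle e u q; have := metric_triangle e q x.
  rewrite (metric_sym q x); lra.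
have := geodesic_segment_mdist segC Cq Cv.
have := metric_triangle e u q; have := metric_triangle e q u.
rewrite (metric_sym q u) => h1 h2 qv.
have : mdist q v <= delta by rewrite qv ler_norml; lra.
have := metric_triangle u q v; lra.
Qed.

End geodesics.

(** * Hyperbolic spaces have finite Nagata dimension *)

Section hyperbolic_nagata.
Context {R : realType} {T : metricType R}.

Lemma hyperbolic_nagata : gromov_hyperbolic T -> bounded_geometry T ->
  exists K c, 0 <= c /\ nagata T K c.
Proof.
move=> [geo [delta delta0 hyp]] bg.
case: (pselect ([set: T] !=set0)) => [[e _]|T0]; last first.
  exists 0%N, 0; split=> // s s0; exists id.
  by split=> x; case: T0; exists x.
pose s1 := 2 * delta + 1.
have s10 : 0 < s1 by rewrite ltr_wpDl// mulr_ge0.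
have [K KP] := bounded_scale_nagata geo bg s1.
exists (K + (K + K))%N, 7; split=> // s s0.
have [ss1|s1s] := leP s s1.
  have [p [pd pfew]] := KP s s0 ss1; exists p; split=> [x|].
    by rewrite (le_trans (pd x))//; lra.
  by apply: locally_few_mono pfew => //; exact: leq_addr.
have [nu [nud nufew]] := KP s1 s10 (lexx _).
(* [m x] is the number of the annulus of [x], of width [3 * s], and [tau x] the
   inner radius of the preceding annulus; the two innermost annuli go to [e]. *)
pose m x := Num.truncn (mdist e x / (3 * s)).
pose tau x := (m x).-1%:R * (3 * s).
have s30 : 0 < 3 * s by rewrite mulr_gt0.
have mP x : (m x)%:R * (3 * s) <= mdist e x < (m x).+1%:R * (3 * s).
  rewrite -ler_pdivlMr// -ltr_pdivrMr//.
  by apply: truncn_itv; rewrite divr_ge0 ?mdist_ge0// ltW.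
have tau_ge0 x : 0 <= tau x by rewrite mulr_ge0// ltW.
have tau_lt x : mdist e x <= tau x + 6 * s.
  have /andP[_] := mP x; rewrite /tau; case: (m x) => [|k] /=; rewrite -?natr1; lra.
have tau_gt x : (0 < m x)%N -> tau x + 3 * s <= mdist e x.
  have /andP[+ _] := mP x; rewrite /tau; case: (m x) => [//|k] /=; rewrite -natr1; lra.
have tau_le x : tau x <= mdist e x.
  have [m0|] := posnP (m x); last by move=> /tau_gt; lra.
  by rewrite /tau m0 mul0r mdist_ge0.
have /choice[G GP] x : exists A, geodesic_segment e x A by exact: geo.
have /choice[g gP] x : exists u, G x u /\ mdist e u = tau x.
  have [|u Gu eu] := geodesic_segment_at (t := tau x) (GP x); last by exists u.
  by rewrite tau_ge0 tau_le.
have xg x : mdist x (g x) <= 6 * s.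
  have [Gg eg] := gP x.
  rewrite (geodesic_segment_mdist (GP x) (geodesic_segment_end (GP x)) Gg) eg.
  by have := tau_lt x; have := tau_le x; rewrite ler_norml; lra.
have gg x z : m x = m z -> mdist x z < 2 * s -> mdist (g x) (g z) < s1.
  move=> mxz xz; have [Gx ex] := gP x; have [Gz ez] := gP z.
  have tz : tau x = tau z by rewrite /tau mxz.
  have [m0|mx] := posnP (m x).
    have -> : g x = g z.
      transitivity e; first by apply/esym/mdist_positivity; rewrite ex /tau m0 mul0r.
      by apply: mdist_positivity; rewrite ez -tz /tau m0 mul0r.
    by rewrite mdistxx.
  suff: mdist (g x) (g z) <= 2 * delta by rewrite /s1; lra.
  apply: (fellow_travel geo hyp _ (GP x) (GP z) Gx Gz ex _ xz (tau_gt x mx)).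
    by move: s1s; rewrite /s1; lra.
  by rewrite ez.
exists (fun x => nu (g x)); split=> [x|x].
  have := metric_triangle x (g x) (nu (g x)); have := xg x; have := nud (g x); lra.
(* One annulus at a time: all its points in the ball are within [2 * s] of any
   chosen one, [y], so their images under [g] are in one ball of radius [s1]. *)
have bucket v : exists l : seq T, (size l <= K)%N /\
    forall z, mdist x z < s -> m z = v -> nu (g z) \in l.
  case: (pselect (exists z, mdist x z < s /\ m z = v)) => [[y [xy <-]]|no]; last first.
    by exists [::]; split=> // z xz mz; case: no; exists z.
  have [l [lK lP]] := nufew (g y); exists l; split=> // z xz mz.
  apply/lP/gg => //; have := metric_triangle y x z.
  by rewrite (metric_sym y x); lra.
have [l1 [l1K l1P]] := bucket (m x).-1.
have [l2 [l2K l2P]] := bucket (m x).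
have [l3 [l3K l3P]] := bucket (m x).+1.
exists (l1 ++ (l2 ++ l3)); split=> [|z xz]; first by rewrite !size_cat !leq_add.
have mle y w : mdist y w < s -> (m y <= (m w).+1)%N.
  move=> yw; rewrite -ltnS -(ltr_nat R) -(ltr_pM2r s30).
  have /andP[+ _] := mP y; have /andP[_] := mP w.
  have := metric_triangle e w y; rewrite (metric_sym w y) -(natr1 (m w).+1).
  lra.
have mxz := mle x z xz; have mzx : (m z <= (m x).+1)%N by apply: mle; rewrite metric_sym.
have [mz|mz] := eqVneq (m z) (m x); first by rewrite !mem_cat l2P ?orbT.
have [mz'|mz'] := eqVneq (m z) (m x).+1; first by rewrite !mem_cat l3P ?orbT.
by rewrite !mem_cat l1P//; lia.
Qed.

End hyperbolic_nagata.

(** * Weighted averages *)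

Section averages.
Context {R : realType} {I : choiceType} {X : normedModType R}.
Implicit Types (u v : I -> R) (q : I -> X) (l : seq I).

Definition average u q : X :=
  (\sum_(j \in [set: I]) u j)^-1 *: \sum_(j \in [set: I]) u j *: q j.

Definition support_le (N : nat) u :=
  exists l : seq I, (size l <= N)%N /\ forall j, u j != 0 -> j \in l.

Lemma fsumE (V : nmodType) l (F : I -> V) : uniq l ->
  (forall j, F j != 0 -> j \in l) ->
  \sum_(j \in [set: I]) F j = \sum_(j <- l) F j.
Proof.
move=> lU lF; rewrite [RHS]fsbig_seq//; apply: esym; apply: fsbig_widen => // j [_ /= jl].
by apply/eqP/negPn/negP => /lF.
Qed.

Lemma averageE u q l : uniq l -> (forall j, u j != 0 -> j \in l) ->
  average u q = (\sum_(j <- l) u j)^-1 *: \sum_(j <- l) u j *: q j.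
Proof.
move=> lU lu; rewrite /average !(@fsumE _ l)// => j.
by apply: contraNT => /(contraNN (lu j)); rewrite negbK => /eqP ->; rewrite scale0r.
Qed.

Lemma le_mass u l j : (forall j, 0 <= u j) -> j \in l -> u j <= \sum_(j <- l) u j.
Proof. by move=> u0 jl; rewrite (big_rem j)//= lerDl sumr_ge0. Qed.

Lemma average_subE u q l (x : X) : uniq l -> (forall j, u j != 0 -> j \in l) ->
  0 < \sum_(j <- l) u j ->
  (\sum_(j <- l) u j) *: (average u q - x) = \sum_(j <- l) u j *: (q j - x).
Proof.
move=> lU lu m0; rewrite (averageE _ lU lu) scalerBr scalerA divff ?gt_eqF//.
rewrite scale1r; under [RHS]eq_bigr do rewrite scalerBr.
by rewrite sumrB scaler_suml.
Qed.

Lemma average_near N u q (x : X) (B : R) : (forall j, 0 <= u j) ->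
  support_le N u -> (exists j, 0 < u j) ->
  (forall j, 0 < u j -> `|q j - x| <= B) -> `|average u q - x| <= B.
Proof.
move=> u0 [l' [_ l'u]] [j0 uj0] qB; pose l := undup l'.
have lu j : u j != 0 -> j \in l by rewrite mem_undup; exact: l'u.
have m0 : 0 < \sum_(j <- l) u j.
  by rewrite (lt_le_trans uj0)// le_mass// lu// gt_eqF.
rewrite -(ler_pM2l m0) -{1}(gtr0_norm m0) -normrZ.
rewrite (average_subE _ _ (undup_uniq _) lu m0) (le_trans (ler_norm_sum _ _ _))//.
rewrite mulr_suml ler_sum// => j _; rewrite normrZ (ger0_norm (u0 j)).
have := u0 j; rewrite le_eqVlt => /predU1P[<-|uj]; first by rewrite !mul0r.
by rewrite ler_pM2l// qB.
Qed.

(** With [W] the mass of [u] and [a] the average for [v], the weights [v] do not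
contribute to the sum of [v j *: (q j - a)], so that [W *: (average u q - a)] is
the sum of the [(u j - v j) *: (q j - a)].  This avoids comparing the two
normalizations. *)
Lemma average_diff N u v q (e b B : R) :
  (forall j, 0 <= u j) -> (forall j, 0 <= v j) ->
  support_le N u -> support_le N v ->
  0 < b -> (exists j, b <= u j) -> (exists j, 0 < v j) ->
  (forall j, `|u j - v j| <= e) ->
  (forall j k, 0 < u j \/ 0 < v j -> 0 < v k -> `|q j - q k| <= B) ->
  `|average u q - average v q| <= (N + N)%:R * (e * B) / b.
Proof.
move=> u0 v0 suppu suppv b0 [j0 uj0] [k0 vk0] uv qB.
have [lu [luN lu_in]] := suppu; have [lv [lvN lv_in]] := suppv.
pose l := undup (lu ++ lv).
have lU : uniq l := undup_uniq _.
have ul j : u j != 0 -> j \in l by rewrite mem_undup mem_cat => /lu_in ->.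
have vl j : v j != 0 -> j \in l by rewrite mem_undup mem_cat => /lv_in ->; rewrite orbT.
have bm : b <= \sum_(j <- l) u j.
  by rewrite (le_trans uj0)// le_mass// ul// gt_eqF// (lt_le_trans b0).
have mu0 : 0 < \sum_(j <- l) u j := lt_le_trans b0 bm.
have mv0 : 0 < \sum_(j <- l) v j.
  by rewrite (lt_le_trans vk0)// le_mass// vl// gt_eqF.
set a := average v q.
have e0 : 0 <= e by rewrite (le_trans (normr_ge0 _) (uv j0)).
have B0 : 0 <= B by rewrite (le_trans (normr_ge0 _) (qB k0 k0 (or_intror vk0) vk0)).
have qa j : 0 < u j \/ 0 < v j -> `|q j - a| <= B.
  move=> uvj; rewrite distrC; apply: (average_near v0 suppv); first by exists k0.
  by move=> k vk; rewrite distrC; exact: qB.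
have diffE : (\sum_(j <- l) u j) *: (average u q - a) =
    \sum_(j <- l) (u j - v j) *: (q j - a).
  under [RHS]eq_bigr do rewrite scalerBl.
  rewrite sumrB -(average_subE q a lU vl mv0) subrr scaler0 subr0.
  exact: average_subE.
rewrite ler_pdivlMr// (le_trans (ler_wpM2l (normr_ge0 _) bm))//.
rewrite mulrC -{1}(gtr0_norm mu0) -normrZ diffE (le_trans (ler_norm_sum _ _ _))//.
apply: (@le_trans _ _ (\sum_(j <- l) e * B)).
  apply: ler_sum => j _; rewrite normrZ.
  have [uvj|/not_orP[uj vj]] := pselect (0 < u j \/ 0 < v j).
    by rewrite ler_pM// qa.
  have [-> ->] : u j = 0 /\ v j = 0.
    by split; apply/eqP; rewrite eq_le ?u0 ?v0 andbT leNgt; exact/negP.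
  by rewrite subrr normr0 mul0r mulr_ge0.
rewrite big_const_seq count_predT iter_addr_0 -[leLHS]mulr_natl.
rewrite ler_wpM2r ?mulr_ge0// ler_nat (leq_trans (size_undup _))//.
by rewrite size_cat leq_add.
Qed.

Lemma average_linear N u (q q' : I -> X) (a : R) : support_le N u ->
  average u (fun j => a *: q j + q' j) = a *: average u q + average u q'.
Proof.
move=> [l' [_ l'u]]; pose l := undup l'.
have lu j : u j != 0 -> j \in l by rewrite mem_undup; exact: l'u.
rewrite !(averageE _ (undup_uniq _) lu) scalerA mulrC -scalerA -scalerDr.
congr (_ *: _); rewrite scaler_sumr -big_split; apply: eq_bigr => j _.
by rewrite scalerDr !scalerA mulrC.
Qed.

End averages.

(** * Suprema of Lipschitz families *)

Section sup_lipschitz.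
Context {R : realType} {A : Type}.

(** The empty family is included, as the supremum of the empty set is [0]. *)
Lemma sup_image_le (U : set A) (G H : A -> R) (B e : R) : 0 <= e ->
  (forall a, H a <= B) -> (forall a, G a <= H a + e) ->
  sup (G @` U) <= sup (H @` U) + e.
Proof.
move=> e0 HB GH; have [->|/set0P[a0 Ua0]] := eqVneq U set0.
  by rewrite !image_set0 sup0 add0r.
apply: ge_sup; first by exists (G a0), a0.
move=> _ [a Ua <-]; rewrite (le_trans (GH a))// lerD2r.
by apply: ub_le_sup; [exists B => _ [b _ <-]|exists a].
Qed.

Lemma sup_image_dist (U : set A) (G H : A -> R) (B e : R) : 0 <= e ->
  (forall a, G a <= B) -> (forall a, H a <= B) ->
  (forall a, `|G a - H a| <= e) ->
  `|sup (G @` U) - sup (H @` U)| <= e.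
Proof.
move=> e0 GB HB GH; rewrite ler_distl lerBlDr; apply/andP; split.
  by apply: (@sup_image_le _ _ _ B) => // a; have := GH a; rewrite ler_norml; lra.
by apply: (@sup_image_le _ _ _ B) => // a; have := GH a; rewrite ler_norml; lra.
Qed.

End sup_lipschitz.

(** * Dyadic scales *)

Section dyadic.
Context {R : realType}.

Definition dyadic (k : int) : R := expR (k%:~R * ln 2).

Lemma dyadic_gt0 k : 0 < dyadic k. Proof. exact: expR_gt0. Qed.

Lemma dyadicS k : dyadic (k + 1) = 2 * dyadic k.
Proof. by rewrite /dyadic intrD mulrDl mul1r expRD lnK ?posrE// mulrC. Qed.

Lemma dyadic_lt k l : (dyadic k < dyadic l) = (k < l).
Proof. by rewrite ltr_expR ltr_pM2r ?ln_gt0 ?ltr1n// ltr_int. Qed.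

Lemma dyadic_scale (t : R) : 0 < t -> exists k, dyadic k <= t < 2 * dyadic k.
Proof.
move=> t0; have ln2 : 0 < ln 2 :> R by rewrite ln_gt0 ?ltr1n.
exists (Num.floor (ln t / ln 2)); rewrite -dyadicS /dyadic.
rewrite -{2 3}(lnK (x := t)) ?posrE// ler_expR ltr_expR.
by rewrite -ler_pdivlMr// -ltr_pdivrMr// floor_itv.
Qed.

End dyadic.

(** * The weights of the extension *)

Section weights.
Context {R : realType} {A M : metricType R} (i : A -> M).
Context (iso : forall a b, mdist (i a) (i b) = mdist a b).
Context (K : nat) (c : R) (p : int -> A -> A).
(* The factor 6: when the weight of scale [k] is active at height [t], two points
   of [A] within [t] and [2 * t] of [x] are less than [3 * t < 6 * dyadic k]
   apart. *)
Context (p_near : forall k a, mdist a (p k a) <= c * (6 * dyadic k)).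
Context (p_few : forall k, locally_few K (6 * dyadic k) (p k)).
Implicit Types (x : M) (t : R) (j : int * A).

(** Positive for [t] strictly between [dyadic k / 4] and [7 * dyadic k / 4]: these
intervals overlap enough for one tent to be at least [t / 6] at each [t > 0]. *)
Definition tent (k : int) (t : R) : R := 3 / 4 * dyadic k - `|t - dyadic k|.

Definition bump (k : int) (x : M) (t : R) (a : A) : R :=
  Num.max 0 (Num.min (tent k t) (2 * t - mdist x (i a))).

(** The index [(k, y)] stands for the cell [p k = y].  As a supremum over the cell
the weight inherits the Lipschitz bound of the bumps, and it vanishes when the
cell is empty. *)
Definition weight (x : M) (t : R) (j : int * A) : R :=
  sup (bump j.1 x t @` [set a | p j.1 a = j.2]).

Definition above x t := exists a, mdist x (i a) < t.

Lemma above_gt0 x t : above x t -> 0 < t.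
Proof. by move=> [a]; exact: le_lt_trans (mdist_ge0 _ _). Qed.

Lemma bump_ge0 k x t a : 0 <= bump k x t a.
Proof. by rewrite le_max lexx. Qed.

Lemma bump_le k x t a : bump k x t a <= 3 / 4 * dyadic k.
Proof.
have := dyadic_gt0 k (R := R) => s0.
rewrite ge_max mulr_ge0 ?(ltW s0)//= ge_min; apply/orP; left.
by rewrite lerBlDr lerDl.
Qed.

Lemma clip_dist (u v u' v' e : R) : `|u - u'| <= e -> `|v - v'| <= e ->
  `|Num.max 0 (Num.min u v) - Num.max 0 (Num.min u' v')| <= e.
Proof.
move=> uu vv; have : `|Num.min u v - Num.min u' v'| <= e.
  move: uu vv; rewrite !ler_norml => /andP[? ?] /andP[? ?].
  by have [?|?] := leP u v; have [?|?] := leP u' v'; lra.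
move: (Num.min u v) (Num.min u' v') => m m'; rewrite !ler_norml => /andP[? ?].
by have [?|?] := leP 0 m; have [?|?] := leP 0 m'; lra.
Qed.

Lemma bump_dist k x t x' t' a :
  `|bump k x t a - bump k x' t' a| <= 2 * (mdist x x' + `|t - t'|).
Proof.
have xx := mdist_ge0 x x'.
apply: clip_dist.
  rewrite /tent; have : `| `|t' - dyadic k| - `|t - dyadic k| | <= `|t - t'|.
    rewrite (le_trans (ler_dist_dist _ _))//.
    by rewrite (distrC t) opprB addrA subrK.
  rewrite !ler_norml; have := normr_ge0 (t - t'); lra.
have := metric_triangle x x' (i a); have := metric_triangle x' x (i a).
rewrite (metric_sym x' x) ler_norml; have := ler_norm (t - t').
have := ler_norm (t' - t); rewrite (distrC t' t); lra.
Qed.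

Lemma weight_ge0 x t j : 0 <= weight x t j.
Proof.
have [U0|/set0P[a Ua]] := eqVneq [set a | p j.1 a = j.2] set0.
  by rewrite /weight U0 image_set0 sup0.
apply: le_trans (bump_ge0 j.1 x t a) _; apply: ub_le_sup; last by exists a.
by exists (3 / 4 * dyadic j.1) => _ [b _ <-]; exact: bump_le.
Qed.

Lemma weight_dist x t x' t' j :
  `|weight x t j - weight x' t' j| <= 2 * (mdist x x' + `|t - t'|).
Proof.
apply: sup_image_dist => [|a|a|a]; [|exact: bump_le|exact: bump_le|exact: bump_dist].
by rewrite mulr_ge0// addr_ge0// mdist_ge0.
Qed.

Lemma bump_gt0 k x t a : 0 < bump k x t a ->
  [/\ dyadic k < 4 * t, 4 * t < 7 * dyadic k & mdist x (i a) < 2 * t].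
Proof.
rewrite lt_max ltxx/= lt_min /tent => /andP[]; rewrite subr_gt0 ltr_norml.
by move=> /andP[? ?] ?; split; lra.
Qed.

Lemma weight_gt0 x t j : 0 < weight x t j ->
  exists2 a, p j.1 a = j.2 &
    [/\ dyadic j.1 < 4 * t, 4 * t < 7 * dyadic j.1 & mdist x (i a) < 2 * t].
Proof.
have [U0|/set0P[a0 Ua0]] := eqVneq [set a | p j.1 a = j.2] set0.
  by rewrite /weight U0 image_set0 sup0 ltxx.
move=> /sup_gt[|_ [a pa <-] /bump_gt0]; last by exists a.
by exists (bump j.1 x t a0), a0.
Qed.

(** An active scale has [dyadic k < 4 * t], so [y] is within [24 * c * t] of a point
of its cell that is within [2 * t] of [x]. *)
Lemma weight_near x t j : 0 <= c -> 0 < weight x t j ->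
  mdist x (i j.2) <= (2 + 24 * c) * t.
Proof.
move=> c0 /weight_gt0[a pa [kt _ xa]].
have := metric_triangle x (i a) (i j.2); rewrite iso -pa.
have := p_near j.1 a; have := ler_wpM2l c0 (ltW kt); lra.
Qed.

(** At most three consecutive scales are active at a given height, and for each of
them the cells concerned meet a ball on which [p k] takes at most [K] values. *)
Lemma weight_support x t : above x t -> support_le (K + (K + K)) (weight x t).
Proof.
move=> xt; have t0 := above_gt0 xt; case: xt => a1 xa1.
have [k0 /andP[k0t tk0]] := dyadic_scale t0.
have [l lP] := choice (fun k => p_few k a1).
pose L k := [seq (k, y) | y <- l k].
exists (L k0 ++ (L (k0 + 1) ++ L (k0 + 1 + 1))); split.
  have lK k : (size (l k) <= K)%N by have [] := lP k.
  by rewrite !size_cat !size_map !leq_add.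
move=> [k y]; rewrite neq_lt ltNge weight_ge0/= => /weight_gt0[a /= <-] [k4 k7 xa].
have inL k' : k = k' -> (k, p k a) \in L k'.
  move=> <-; apply: map_f; have [_] := lP k; apply; rewrite -iso.
  have := metric_triangle (i a1) x (i a); rewrite (metric_sym (i a1) x).
  have := dyadic_gt0 (R := R) k; lra.
have kk0 : k0 < k + 1 by rewrite -(dyadic_lt (R := R)) dyadicS;
  have := dyadic_gt0 (R := R) k; lra.
have k0k : k < k0 + 1 + 1 + 1 by rewrite -(dyadic_lt (R := R)) !dyadicS; lra.
have : k = k0 \/ k = k0 + 1 \/ k = k0 + 1 + 1 by lia.
by rewrite !mem_cat => -[|[]] /inL ->; rewrite ?orbT.
Qed.

Lemma weight_large x t : above x t -> exists j, t / 6 <= weight x t j.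
Proof.
move=> xt; have t0 := above_gt0 xt; case: xt => a xa.
have [k0 /andP[k0t tk0]] := dyadic_scale t0.
have [k tk] : exists k, t / 6 <= tent k t.
  have [h|h] := leP t (3 / 2 * dyadic k0).
    by exists k0; rewrite /tent ger0_norm ?subr_ge0//; lra.
  by exists (k0 + 1); rewrite /tent dyadicS ler0_norm; lra.
exists (k, p k a); apply: (@le_trans _ _ (bump k x t a)).
  by rewrite le_max le_min tk/=; apply/orP; right; lra.
apply: ub_le_sup; last by exists a.
by exists (3 / 4 * dyadic k) => _ [b _ <-]; exact: bump_le.
Qed.

End weights.

(** * The extension operator *)

Section limits.
Context {R : realType} {X : completeNormedModType R}.
Implicit Types u v : nat -> X.

Lemma cvg_of_harmonic u (B : R) : 0 <= B ->
  (forall n m, `|u n - u m| <= B * `|harmonic n - harmonic m|) -> cvgn u.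
Proof.
move=> B0 uB; apply: cauchy_cvg; apply: cauchy_exP => e e0.
have B1 : 0 < B + 1 by rewrite ltr_wpDl.
have /cvgrPdist_lt/(_ (e / (B + 1)) (divr_gt0 e0 B1))[N _ small] := @cvg_harmonic R.
exists (u N), N => // n /= Nn; rewrite -ball_normE/=.
rewrite (le_lt_trans (uB _ _))// (@le_lt_trans _ _ (B * (e / (B + 1))))//.
  rewrite ler_wpM2l//; have := small N (leqnn N); have := small n Nn.
  rewrite !sub0r !normrN !(ger0_norm (harmonic_ge0 _)) => hn hN.
  have := harmonic_ge0 (R := R) n; have := harmonic_ge0 (R := R) N.
  by rewrite ler_norml; lra.
by rewrite mulrA ltr_pdivrMr// mulrC ltr_pM2l// ltrDl.
Qed.

Lemma lim_dist_le u v (B : R) : cvgn u -> cvgn v ->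
  (forall n, `|u n - v n| <= B) -> `|limn u - limn v| <= B.
Proof.
move=> cu cv uvB; have c : `|u n - v n| @[n --> \oo] --> `|limn u - limn v|.
  by apply: cvg_norm; exact: cvgB.
by apply: ler_cvg_to c (cvg_cst B) _; near=> n; exact: uvB.
Unshelve. all: by end_near. Qed.

End limits.

(** The Lipschitz constant of [extend_at]: with at most [N = 3 * K] nonzero weights
at each point and [gamma = 2 + 24 * c] as in [weight_near], it is
[(24 * N + 1) * (2 * gamma + 1)]. *)
Definition extension_bound {R : realType} (K : nat) (c : R) : R :=
  (12 * ((K + (K + K)) + (K + (K + K)))%:R + 1) * (2 * (2 + 24 * c) + 1).

Lemma extension_bound_ge0 {R : realType} K (c : R) : 0 <= c -> 0 <= extension_bound K c.
Proof. by move=> c0; rewrite mulr_ge0// addr_ge0// mulr_ge0// addr_ge0// mulr_ge0. Qed.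

Section extend.
Context {R : realType} {A M : metricType R} (i : A -> M) (X : completeNormedModType R).
Context (iso : forall a b, mdist (i a) (i b) = mdist a b).
Context (K : nat) (c : R) (p : int -> A -> A) (a0 : A) (c0 : 0 <= c).
Context (p_near : forall k a, mdist a (p k a) <= c * (6 * dyadic k)).
Context (p_few : forall k, locally_few K (6 * dyadic k) (p k)).
Implicit Types (x : M) (t : R) (f g : A -> X) (L : R).

Let above := above i.
Let weight := weight i p.
Let N := (K + (K + K))%N.
Let gamma : R := 2 + 24 * c.

Definition lip f L := 0 <= L /\ forall a b, `|f a - f b| <= L * mdist a b.

Definition extend_at f x t : X := average (weight x t) (fun j => f j.2).

Let gamma0 : 0 <= gamma. Proof. by rewrite addr_ge0// mulr_ge0. Qed.

Let weight_pos x t : above x t -> exists j, 0 < weight x t j.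
Proof.
move=> xt; have [j jw] := weight_large p xt; exists j.
by rewrite (lt_le_trans _ jw)// divr_gt0// (above_gt0 xt).
Qed.

(** Let [d] be the distance between the two points and [t] the larger height.  The
values averaged differ by at most [L * (2 * gamma * t + d)].  If [d > t] this is
already enough; if [d <= t], then each weight changes by at most [2 * d] while
the mass is at least [t / 6], so the factor [t] in the bound for the values
cancels in [average_diff]. *)
Lemma extend_at_lip f L x t x' t' : lip f L -> above x t -> above x' t' ->
  `|extend_at f x t - extend_at f x' t'| <=
    extension_bound K c * L * (mdist x x' + `|t - t'|).
Proof.
move=> [L0 fL]; wlog tt : x t x' t' / t' <= t => [wl|] xt xt'.
  have [/wl|/ltW/wl h] := leP t' t; first exact.
  by rewrite distrC metric_sym (distrC t); exact: h.
have t0 := above_gt0 xt.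
have xx := mdist_ge0 x x'.
set d := mdist x x' + `|t - t'|.
have d0 : 0 <= d by rewrite addr_ge0.
have xxd : mdist x x' <= d by rewrite lerDl.
have close j k : 0 < weight x t j \/ 0 < weight x' t' j -> 0 < weight x' t' k ->
    `|f j.2 - f k.2| <= L * (2 * gamma * t + d).
  move=> wj /(weight_near iso p_near c0) wk.
  rewrite (le_trans (fL _ _))// ler_wpM2l// -iso.
  have gt : gamma * t' <= gamma * t by rewrite ler_wpM2l.
  have := metric_triangle (i j.2) x' (i k.2); rewrite (metric_sym _ x').
  have := metric_triangle x' x (i j.2); rewrite (metric_sym x' x).
  move: wk gt; rewrite /gamma => wk gt.
  by case: wj => /(weight_near iso p_near c0) wj; lra.
have wge0 x1 t1 j : 0 <= weight x1 t1 j := weight_ge0 i p x1 t1 j.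
have supp x1 t1 : above x1 t1 -> support_le N (weight x1 t1).
  exact: (weight_support iso p_few).
set G := 2 * gamma + 1; have G0 : 0 <= G by rewrite addr_ge0// mulr_ge0.
have LGd : 0 <= L * G * d by rewrite !mulr_ge0.
have -> : extension_bound K c * L * d =
    12 * (N + N)%:R * (L * G * d) + L * G * d.
  by rewrite /extension_bound -/gamma -/N -/G; ring.
have [dt|td] := leP d t.
  apply: (@le_trans _ _ ((N + N)%:R * (2 * d * (L * (2 * gamma * t + d))) / (t / 6))).
    apply: average_diff => //; try exact: supp.
    - by rewrite divr_gt0.
    - exact: (weight_large p).
    - exact: weight_pos.
    - by move=> j; exact: (weight_dist i p x t x' t' j).
  rewrite ler_pdivrMr ?divr_gt0//.
  apply: (@le_trans _ _ ((N + N)%:R * (2 * d * (L * (G * t))))).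
    rewrite ler_wpM2l// ler_wpM2l ?mulr_ge0// ler_wpM2l//.
    by rewrite /G; lra.
  have -> : (N + N)%:R * (2 * d * (L * (G * t))) =
    12 * (N + N)%:R * (L * G * d) * (t / 6) by field.
  by rewrite ler_wpM2r ?lerDl// ltW// divr_gt0.
apply: (@le_trans _ _ (L * (2 * gamma * t + d))); last first.
  apply: (@le_trans _ _ (L * G * d)); last by rewrite lerDr !mulr_ge0.
  rewrite -(mulrA L) ler_wpM2l//.
  have : gamma * t <= gamma * d by rewrite ler_wpM2l// ltW.
  by rewrite /G; lra.
apply: (average_near (wge0 x t) (supp _ _ xt) (weight_pos xt)) => j wj.
rewrite distrC; apply: (average_near (wge0 x' t') (supp _ _ xt')
  (weight_pos xt')) => k wk.
by rewrite distrC; apply: close => //; left.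
Qed.

Lemma extend_at_near f L a t : lip f L -> 0 < t ->
  `|extend_at f (i a) t - f a| <= L * gamma * t.
Proof.
move=> [L0 fL] t0; have at' : above (i a) t by exists a; rewrite mdistxx.
apply: (average_near (weight_ge0 i p _ _) (weight_support iso p_few at')
  (weight_pos at')) => j /(weight_near iso p_near c0).
rewrite iso => aj; rewrite (le_trans (fL _ _))// metric_sym -mulrA ler_wpM2l//.
Qed.

(** The infimum of the distances, written so that [sup_image_dist] applies. *)
Definition dist_to x : R := - sup ((fun a => - mdist x (i a)) @` setT).

Lemma dist_to_above x t : dist_to x < t -> above x t.
Proof.
rewrite /dist_to ltrNl => /sup_gt[|_ [a _ <-]]; first by exists (- mdist x (i a0)), a0.
by rewrite ltrN2; exists a.
Qed.

Lemma dist_to_dist x x' : `|dist_to x - dist_to x'| <= mdist x x'.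
Proof.
rewrite /dist_to opprK addrC distrC.
apply: (@sup_image_dist _ _ _ _ _ 0); rewrite ?mdist_ge0// => a;
  rewrite ?oppr_le0 ?mdist_ge0//.
have := metric_triangle x x' (i a); have := metric_triangle x' x (i a).
by rewrite (metric_sym x' x) ler_norml; lra.
Qed.

Lemma dist_to_id a : dist_to (i a) = 0.
Proof.
apply/eqP; rewrite oppr_eq0 eq_le; apply/andP; split.
  apply: ge_sup; first by exists (- mdist (i a) (i a0)), a0.
  by move=> _ [b _ <-]; rewrite oppr_le0 mdist_ge0.
apply: ub_le_sup; last by exists a; rewrite // mdistxx oppr0.
by exists 0 => _ [b _ <-]; rewrite oppr_le0 mdist_ge0.
Qed.

Definition approx f x n : X := extend_at f x (dist_to x + harmonic n).

(** Along these heights [extend_at f x] is Cauchy, being Lipschitz in the height;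
this is where completeness of [X] enters. *)
Definition extend f x : X := limn (approx f x).

Let approx_above x n : above x (dist_to x + harmonic n).
Proof. by apply: dist_to_above; rewrite ltrDl harmonic_gt0. Qed.

Lemma approx_cvg f L x : lip f L -> cvgn (approx f x).
Proof.
move=> fL; apply: (@cvg_of_harmonic _ _ _ (extension_bound K c * L)) => [|n m].
  by rewrite mulr_ge0 ?extension_bound_ge0//; case: fL.
apply: le_trans (extend_at_lip fL (approx_above x n) (approx_above x m)) _.
by rewrite mdistxx add0r opprD addrACA subrr add0r.
Qed.

(** The factor [2] is the contribution of the heights, since [dist_to] is itself
1-Lipschitz. *)
Lemma extend_lip f L x x' : lip f L ->
  `|extend f x - extend f x'| <= 2 * extension_bound K c * L * mdist x x'.
Proof.
move=> fL; have [L0 _] := fL.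
apply: lim_dist_le; [exact: approx_cvg fL|exact: approx_cvg fL|move=> n].
apply: le_trans (extend_at_lip fL (approx_above x n) (approx_above x' n)) _.
have -> : 2 * extension_bound K c * L * mdist x x' =
  extension_bound K c * L * (mdist x x' + mdist x x') by ring.
apply: ler_wpM2l; first by rewrite mulr_ge0 ?extension_bound_ge0.
by rewrite lerD2l opprD addrACA subrr addr0 dist_to_dist.
Qed.

Lemma extend_id f L a : lip f L -> extend f (i a) = f a.
Proof.
move=> fL; apply: cvg_lim => //; apply/cvgrPdist_le => e e0.
have [L0 _] := fL.
have B0 : 0 < L * gamma + 1 by rewrite ltr_wpDl// mulr_ge0.
have /cvgrPdist_le/(_ (e / (L * gamma + 1)) (divr_gt0 e0 B0)) := @cvg_harmonic R.
apply: filterS => n; rewrite sub0r normrN ger0_norm ?harmonic_ge0// => ne.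
rewrite distrC /approx dist_to_id add0r.
apply: le_trans (extend_at_near a fL (harmonic_gt0 n)) _.
apply: le_trans (ler_wpM2l (mulr_ge0 L0 gamma0) ne) _.
by rewrite mulrA ler_pdivrMr// mulrC ler_wpM2l ?lerDl// ltW.
Qed.

Lemma extend_linear f g L L' (a : R) x : lip f L -> lip g L' ->
  extend (fun b => a *: f b + g b) x = a *: extend f x + extend g x.
Proof.
move=> fL gL; apply: cvg_lim => //.
rewrite [X in X @ _ --> _](_ : _ = fun n => a *: approx f x n + approx g x n).
  by apply: cvgD; [apply: cvgZr|]; exact: approx_cvg fL || exact: approx_cvg gL.
apply/funext => n; apply: average_linear.
exact: (weight_support iso p_few (approx_above x n)).
Qed.

End extend.

(** * Extension constants *)

Section seminorm.
Context {R : realType} {A : metricType R} {X : completeNormedModType R}.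
Implicit Type f : Lip A X.

Let slopes f := [set r | exists x y : A, x <> y /\ r = `|f x - f y| / mdist x y].

Lemma lip_seminorm_le f (C : R) : lip f C -> lip_seminorm f <= C.
Proof.
move=> [C0 fC]; have [U0|/set0P U0] := eqVneq (slopes f) set0.
  by rewrite /lip_seminorm -/(slopes f) U0 sup0.
apply: ge_sup => // _ [x [y [/eqP xy ->]]].
by rewrite ler_pdivrMr ?mdist_gt0.
Qed.

Lemma lip_seminormP f : lip f (lip_seminorm f).
Proof.
have [k fk] : exists k : R, forall x y, `|f x - f y| <= k * mdist x y.
  by have := lip_funP f; rewrite inE.
have ub : has_ubound (slopes f).
  exists k => _ [x [y [/eqP xy ->]]].
  by rewrite ler_pdivrMr ?mdist_gt0.
split=> [|x y].
  have [U0|/set0P[r Ur]] := eqVneq (slopes f) set0.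
    by rewrite /lip_seminorm -/(slopes f) U0 sup0.
  rewrite (le_trans _ (ub_le_sup ub Ur))//.
  by case: Ur => [x [y [_ ->]]]; rewrite divr_ge0// mdist_ge0.
have [->|xy] := eqVneq x y; first by rewrite subrr normr0 mdistxx mulr0.
rewrite -ler_pdivrMr ?mdist_gt0//; apply: ub_le_sup => //.
by exists x, y; split=> //; exact/eqP.
Qed.

End seminorm.

Lemma extension_constant_le {R : realType} (M : metricType R) (S : set M)
    (X : completeNormedModType R) (C : R) (E : (S -> X) -> M -> X) : 0 <= C ->
  (forall f L, lip f L -> lip (E f) (C * L)) ->
  (forall f L s, lip f L -> E f (val s) = f s) ->
  (forall f g L L' (a : R) x, lip f L -> lip g L' ->
    E (fun s => a *: f s + g s) x = a *: E f x + E g x) ->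
  (extension_constant S X <= C%:E)%E.
Proof.
move=> C0 Elip Eid Elin.
have EP (f : Lip S X) : E f \in @metric_lipschitz _ M X.
  by rewrite inE; exists (C * lip_seminorm f); have [_] := Elip _ _ (lip_seminormP f).
pose T0 f := MkLip (EP f).
have T0lin : linear T0.
  move=> a f g; apply/val_inj/funext => x.
  exact: (Elin _ _ _ _ _ _ (lip_seminormP f) (lip_seminormP g)).
pose Tlin := GRing.isLinear.Build R (Lip S X) (Lip M X) _ T0 T0lin.
pose T : {linear Lip S X -> Lip M X} := HB.pack T0 Tlin.
have TC (f : Lip S X) : lip_seminorm (T f) <= C * lip_seminorm f.
  exact/lip_seminorm_le/Elip/lip_seminormP.
apply: (@le_trans _ _ (operator_norm T)).
  apply: ereal_inf_lbound; exists T => //; split.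
    move=> f e e0; have C1 : 0 < C + 1 by rewrite ltr_wpDl.
    exists (e / (C + 1)); first exact: divr_gt0.
    move=> g; rewrite ltr_pdivlMr// => ge; rewrite -linearB.
    rewrite (le_lt_trans (TC _))// (le_lt_trans _ ge)// mulrC ler_wpM2l ?lerDl//.
    by have [] := lip_seminormP (g - f).
  by move=> f s; exact: (Eid _ _ _ (lip_seminormP f)).
apply: ge_ereal_sup => _ [f /= f1 <-]; rewrite lee_fin.
by rewrite (le_trans (TC f))// -[leRHS]mulr1 ler_wpM2l.
Qed.

Lemma nagata_extension_constant {R : realType} (M : metricType R) (S : set M)
    (X : completeNormedModType R) K (c : R) : 0 <= c -> nagata S K c ->
  (extension_constant S X <= (2 * extension_bound K c)%:E)%E.
Proof.
move=> c0 nS; have C0 : 0 <= 2 * extension_bound K c.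
  by rewrite mulr_ge0// extension_bound_ge0.
have [[s0 _]|S0] := pselect ([set: S] !=set0); last first.
  apply: (@extension_constant_le _ _ _ _ _ (fun _ _ => 0)) => //.
  - move=> f L [L0 _]; split=> [|x y]; first exact: mulr_ge0.
    by rewrite subrr normr0 mulr_ge0 ?mdist_ge0// mulr_ge0.
  - by move=> f L s; case: S0; exists s.
  - by move=> *; rewrite scaler0 addr0.
have /choice[p pP] k : exists p : S -> S,
    (forall x, mdist x (p x) <= c * (6 * dyadic k)) /\ locally_few K (6 * dyadic k) p.
  by apply: nS; rewrite mulr_gt0// dyadic_gt0.
have p_near k := (pP k).1; have p_few k := (pP k).2.
have iso (a b : S) : mdist (val a) (val b) = mdist a b by [].
apply: (@extension_constant_le _ _ _ _ _ (extend (fun s : S => val s) p)) => //.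
- move=> f L fL; split; first by have [L0 _] := fL; exact: mulr_ge0.
  by move=> x y; exact: (extend_lip iso s0 c0 p_near p_few).
- by move=> f L s; exact: (extend_id iso s0 c0 p_near p_few).
- by move=> f g L L' a x; exact: (extend_linear iso s0 c0 p_near p_few).
Qed.

Lemma nagata_universal {R : realType} (U : metricType R) K (c : R) :
  0 <= c -> nagata U K c -> universal U.
Proof.
move=> c0 nU; exists (2 * extension_bound K (2 * c)) => M S [V [phi [_ phiI]]] X.
apply: nagata_extension_constant; first exact: mulr_ge0.
by apply: (@nagata_isometric _ _ _ (fun s => val (phi s))) nU => x y; rewrite -phiI.
Qed.

(** * Universality of the sum *)

Theorem theorem1p5 (R : realType) (N : nat) (M : 'I_N -> metricType R) :
  (1 <= N)%N ->
  (forall i, gromov_hyperbolic (M i)) ->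
  (forall i, bounded_geometry (M i)) ->
  universal (direct_sum M).
Proof.
move=> _ hyp geo.
have [K [c [c0 nM]]] := nagata_direct_sum (fun i => hyperbolic_nagata (hyp i) (geo i)).
exact: nagata_universal nM.
Qed.
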